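(* Let $Q\in\mathbb{R}^{n\times n}$, $Q\succeq0$, $R\in\mathbb{R}^{m\times m}$, $R\succ0$, $\sigma_w>0$, $\lambda\ge0$, and let $\Psi,\Psi_1,\Psi_2,\bar X_1$ be the matrices defined in the context. Consider the direct problem $$ \begin{aligned} \min_{V,\ \Sigma\succeq 0}\quad & \operatorname{Tr}\bigl((Q+V^\top\Psi_1^\top R\Psi_1V)\Sigma\bigr)+\lambda\operatorname{Tr}(\Psi V\Sigma V^\top)\\ \text{s.t.}\quad & \Sigma=\sigma_w^2I_n+\bar X_1V\Sigma V^\top\bar X_1^\top,\qquad I_n=\Psi_2V \end{aligned} $$ over $V\in\mathbb{R}^{(n+m)\times n}$ and symmetric $\Sigma\in\mathbb{R}^{n\times n}$, with associated gain $K=\Psi_1V$. If this problem is feasible, then an optimal gain for it can be computed as $K=\Psi_1S\Sigma^{-1}$, where $S,\Sigma$ are given by the semidefinite program $$ \begin{aligned} \min_{\Sigma,S,L,M}\quad & \operatorname{Tr}(Q\Sigma)+\operatorname{Tr}(RL)+\lambda\operatorname{Tr}(M\Psi)\\ \text{s.t.}\quad & \Psi_2S=\Sigma,\qquad \begin{bmatrix}\Sigma-\sigma_w^2I_n & \bar X_1S\\ S^\top\bar X_1^\top & \Sigma\end{bmatrix}\succeq0,\\ & \begin{bmatrix}L & \Psi_1S\\ S^\top\Psi_1^\top & \Sigma\end{bmatrix}\succeq0,\qquad \begin{bmatrix}M & S\\ S^\top & \Sigma\end{bmatrix}\succeq0, \end{aligned} $$ with symmetric $\Sigma\in\mathbb{R}^{n\times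 n}$, $L\in\mathbb{R}^{m\times m}$, $M\in\mathbb{R}^{(n+m)\times(n+m)}$ and $S\in\mathbb{R}^{(n+m)\times n}$. That is, if $(\Sigma,S,L,M)$ is an optimal solution of the semidefinite program, then $\Sigma$ is invertible and there is an optimal solution $(V,\Sigma')$ of the direct problem with $\Psi_1V=\Psi_1S\Sigma^{-1}$.
   Context: Data matrices $X_0\in\mathbb{R}^{n\times T}$, $U_0\in\mathbb{R}^{m\times T}$, $X_1\in\mathbb{R}^{n\times T}$ are given (states, inputs, successor states of a linear system $x_{k+1}=Ax_k+Bu_k+w_k$ with noise variance $\sigma_w^2I_n$), with $D_0=\begin{bmatrix} U_0 \\ X_0 \end{bmatrix}\in\mathbb{R}^{(m+n)\times T}$ satisfying $\operatorname{rank}(D_0)=n+m$. Prior parameters: $[\bar B\ \ \bar A]$ with $\bar B\in\mathbb{R}^{n\times m}$, $\bar A\in\mathbb{R}^{n\times n}$, and $\Omega=\begin{bmatrix}\Omega_B&0\\0&\Omega_A\end{bmatrix}\succeq0$ with $\Omega_B\in\mathbb{R}^{m\times m}$, $\Omega_A\in\mathbb{R}^{n\times n}$. Define $$\Psi=(D_0D_0^\top+\sigma_w^2\Omega)/T\succ0,\qquad \Psi=\begin{bmatrix}\Psi_1\\ \Psi_2\end{bmatrix},\ \Psi_1\in\mathbb{R}^{m\times(n+m)},\ \Psi_2\in\mathbb{R}^{n\times(n+m)},$$ $$\bar X_1=\tfrac1T\bigl(X_1D_0^\top+\sigma_w^2[\bar B\ \ \bar A]\Omega\bigr)\in\mathbb{R}^{n\times(n+m)}.$$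 A gain $K$ is called optimal for the direct problem if $K=\Psi_1V$ for some optimal solution $(V,\Sigma)$ of that problem. *)

(* Defs.v *)
From mathcomp Require Import all_boot all_order all_algebra.
From mathcomp Require Import reals.

Set Implicit Arguments.
Unset Strict Implicit.
Unset Printing Implicit Defensive.

Import Order.TTheory GRing.Theory Num.Theory.
Local Open Scope ring_scope.

Definition psdmx (R : realType) (n : nat) (A : 'M[R]_n) : Prop :=
  A \is symmetricmx /\ forall x : 'cV[R]_n, 0 <= (x^T *m A *m x) 0 0.

Definition pdmx (R : realType) (n : nat) (A : 'M[R]_n) : Prop :=
  A \is symmetricmx /\
  forall x : 'cV[R]_n, x != 0 -> 0 < (x^T *m A *m x) 0 0.

(* Inputs are stacked above states throughout, so the joint dimension is
   written m + n: the upper m rows of Psi are Psi_1, the lower n rows Psi_2. *)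
Section DataMatrices.

Context {R : realType} {n m T : nat}.

Definition data_mx (U0 : 'M[R]_(m, T)) (X0 : 'M[R]_(n, T)) : 'M[R]_(m + n, T) :=
  col_mx U0 X0.

Definition prior_weight (OmegaB : 'M[R]_m) (OmegaA : 'M[R]_n) : 'M[R]_(m + n) :=
  block_mx OmegaB 0 0 OmegaA.

Definition prior_mean (Bbar : 'M[R]_(n, m)) (Abar : 'M[R]_n) : 'M[R]_(n, m + n) :=
  row_mx Bbar Abar.

Definition Psi_mx (sigma_w : R) (D0 : 'M[R]_(m + n, T)) (Omega : 'M[R]_(m + n)) :
    'M[R]_(m + n) :=
  T%:R^-1 *: (D0 *m D0^T + sigma_w ^+ 2 *: Omega).

Definition X1bar_mx (sigma_w : R) (X1 : 'M[R]_(n, T)) (D0 : 'M[R]_(m + n, T))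
    (BAbar : 'M[R]_(n, m + n)) (Omega : 'M[R]_(m + n)) : 'M[R]_(n, m + n) :=
  T%:R^-1 *: (X1 *m D0^T + sigma_w ^+ 2 *: (BAbar *m Omega)).

End DataMatrices.

Section Problems.

Context {R : realType} {n m : nat}.

Variables (Q : 'M[R]_n) (Rc : 'M[R]_m) (sigma_w lambda : R).
Variables (Psi : 'M[R]_(m + n)) (X1bar : 'M[R]_(n, m + n)).

Let Psi1 : 'M[R]_(m, m + n) := usubmx Psi.
Let Psi2 : 'M[R]_(n, m + n) := dsubmx Psi.

Definition direct_cost (V : 'M[R]_(m + n, n)) (Sigma : 'M[R]_n) : R :=
  \tr ((Q + V^T *m Psi1^T *m Rc *m Psi1 *m V) *m Sigma)
  + lambda * \tr (Psi *m V *m Sigma *m V^T).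

Definition direct_feasible (V : 'M[R]_(m + n, n)) (Sigma : 'M[R]_n) : Prop :=
  [/\ psdmx Sigma,
      Sigma = (sigma_w ^+ 2)%:M + X1bar *m V *m Sigma *m V^T *m X1bar^T
    & 1%:M = Psi2 *m V].

Definition direct_optimal (V : 'M[R]_(m + n, n)) (Sigma : 'M[R]_n) : Prop :=
  direct_feasible V Sigma /\
  forall (V' : 'M[R]_(m + n, n)) (Sigma' : 'M[R]_n),
    direct_feasible V' Sigma' -> direct_cost V Sigma <= direct_cost V' Sigma'.

Definition direct_optimal_gain (K : 'M[R]_(m, n)) : Prop :=
  exists (V : 'M[R]_(m + n, n)) (Sigma : 'M[R]_n),
    direct_optimal V Sigma /\ K = Psi1 *m V.

Definition sdp_cost (Sigma : 'M[R]_n) (S : 'M[R]_(m + n, n)) (L : 'M[R]_m)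
    (M : 'M[R]_(m + n)) : R :=
  \tr (Q *m Sigma) + \tr (Rc *m L) + lambda * \tr (M *m Psi).

Definition sdp_feasible (Sigma : 'M[R]_n) (S : 'M[R]_(m + n, n)) (L : 'M[R]_m)
    (M : 'M[R]_(m + n)) : Prop :=
  [/\ Sigma \is symmetricmx, L \is symmetricmx & M \is symmetricmx] /\
  [/\ Psi2 *m S = Sigma,
      psdmx (block_mx (Sigma - (sigma_w ^+ 2)%:M) (X1bar *m S)
                      (S^T *m X1bar^T)            Sigma),
      psdmx (block_mx L                (Psi1 *m S)
                      (S^T *m Psi1^T)  Sigma)
    & psdmx (block_mx M    S
                      S^T  Sigma)].

Definition sdp_optimal (Sigma : 'M[R]_n) (S : 'M[R]_(m + n, n)) (L : 'M[R]_m)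
    (M : 'M[R]_(m + n)) : Prop :=
  sdp_feasible Sigma S L M /\
  forall (Sigma' : 'M[R]_n) (S' : 'M[R]_(m + n, n)) (L' : 'M[R]_m)
         (M' : 'M[R]_(m + n)),
    sdp_feasible Sigma' S' L' M' -> sdp_cost Sigma S L M <= sdp_cost Sigma' S' L' M'.

End Problems.

(* Main.v *)
(* A direct-feasible (V, Sigma) is SDP-feasible at the same cost, with
   S = V Sigma, L = (Psi1 V) Sigma (Psi1 V)^T and M = V Sigma V^T.  Conversely,
   Schur complements show that an SDP-feasible point with V = S Sigma^-1 and
   closed loop A = X1bar V satisfies Sigma >= sigma_w^2 I + A Sigma A^T,
   L >= (Psi1 V) Sigma (Psi1 V)^T and M >= V Sigma V^T.  The first inequality
   makes Sigma a strict Lyapunov certificate for A, so the equation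
   Sigma' = sigma_w^2 I + A Sigma' A^T has a positive semidefinite solution
   Sigma' <= Sigma.  Then (V, Sigma') is direct-feasible and, since traces
   against positive semidefinite weights are monotone, costs no more. *)
Require Import Defs.
From mathcomp Require Import all_boot all_order all_algebra.
From mathcomp Require Import reals.
From mathcomp Require Import ring lra.

Set Implicit Arguments.
Unset Strict Implicit.
Unset Printing Implicit Defensive.

Import Order.TTheory GRing.Theory Num.Theory.
Local Open Scope ring_scope.

(** * Transpose symmetry, Euclidean norms and a bound on bilinear forms *)

Lemma symmetricmxP (F : fieldType) (n : nat) (A : 'M[F]_n) :
  reflect (A^T = A) (A \is symmetricmx).
Proof.
rewrite is_hermitianmxE expr0 scale1r map_mx_id // eq_sym.
exact: eqP.
Qed.

Lemma sqnormE (F : realFieldType) (n : nat) (x : 'cV[F]_n) :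
  (x^T *m x) 0 0 = \sum_i x i 0 ^+ 2.
Proof. by rewrite mxE; apply: eq_bigr => i _; rewrite mxE expr2. Qed.

Lemma sqnorm_ge0 (F : realFieldType) (n : nat) (x : 'cV[F]_n) :
  0 <= (x^T *m x) 0 0.
Proof. by rewrite sqnormE sumr_ge0 // => i _; rewrite sqr_ge0. Qed.

Lemma sqnorm_le0 (F : realFieldType) (n : nat) (x : 'cV[F]_n) :
  (x^T *m x) 0 0 <= 0 -> x = 0.
Proof.
move=> le0; have /eqP : (x^T *m x) 0 0 = 0.
  by apply/eqP; rewrite eq_le le0 sqnorm_ge0.
rewrite sqnormE psumr_eq0 => [/allP x0|i _]; last exact: sqr_ge0.
apply/colP => i; have := x0 i; rewrite mem_index_enum sqrf_eq0 mxE.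
by move/(_ isT)/eqP.
Qed.

Lemma sqr_coord_le_sqnorm (F : realFieldType) (n : nat) (x : 'cV[F]_n) i :
  x i 0 ^+ 2 <= (x^T *m x) 0 0.
Proof.
by rewrite sqnormE (bigD1 i) //= lerDl sumr_ge0 // => j _; rewrite sqr_ge0.
Qed.

(** Each product [x_i z_j] is at most [|x|^2 + |z|^2] in absolute value, so the sum of the [|Y i j|]
    can serve as [t]. The Lyapunov descent uses this to control an arbitrary form by squared
    norms. *)
Lemma bilinear_bound (F : realFieldType) (n : nat) (Y : 'M[F]_n) :
  exists2 t : F, 0 <= t & forall x z : 'cV[F]_n,
    - (t * ((x^T *m x) 0 0 + (z^T *m z) 0 0)) <= (x^T *m Y *m z) 0 0.
Proof.
exists (\sum_j \sum_i `|Y i j|) => [|x z].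
  by apply: sumr_ge0 => j _; apply: sumr_ge0 => i _.
rewrite mulr_suml -sumrN [leRHS]mxE; apply: ler_sum => j _.
rewrite mulr_suml -sumrN [in leRHS]mxE mulr_suml; apply: ler_sum => i _.
rewrite [in leRHS]mxE.
have := sqr_coord_le_sqnorm x i; have := sqr_coord_le_sqnorm z j.
set a := (x^T *m x) 0 0; set b := (z^T *m z) 0 0 => zb xa.
have xz : `|x i 0 * z j 0| <= a + b.
  by rewrite ler_norml; apply/andP; split; nra.
have : `|x i 0 * Y i j * z j 0| <= `|Y i j| * (a + b).
  by rewrite mulrAC mulrC normrM ler_wpM2l.
by rewrite ler_norml => /andP[].
Qed.

(** * Positive semidefinite matrices: congruence, Schur complements, factorization, traces *)

Section PositiveSemidefinite.

Variable R : realType.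

Lemma psdmx_tr (n : nat) (A : 'M[R]_n) : psdmx A -> A^T = A.
Proof. by case=> /symmetricmxP. Qed.

Lemma psdmxD (n : nat) (A B : 'M[R]_n) : psdmx A -> psdmx B -> psdmx (A + B).
Proof.
move=> [/symmetricmxP sA pA] [/symmetricmxP sB pB]; split.
  by apply/symmetricmxP; rewrite linearD /= sA sB.
by move=> x; rewrite mulmxDr mulmxDl mxE addr_ge0.
Qed.

Lemma psdmxZ (n : nat) (a : R) (A : 'M[R]_n) :
  0 <= a -> psdmx A -> psdmx (a *: A).
Proof.
move=> a0 [/symmetricmxP sA pA]; split.
  by apply/symmetricmxP; rewrite linearZ /= sA.
by move=> x; rewrite -scalemxAr -scalemxAl mxE mulr_ge0.
Qed.

Lemma psdmx_congr (n p : nat) (A : 'M[R]_n) (N : 'M[R]_(p, n)) :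
  psdmx A -> psdmx (N *m A *m N^T).
Proof.
move=> [/symmetricmxP sA pA]; split.
  by apply/symmetricmxP; rewrite !trmx_mul trmxK sA mulmxA.
by move=> x; have := pA (N^T *m x); rewrite trmx_mul trmxK !mulmxA.
Qed.

Lemma psdmx_gram (n p : nat) (N : 'M[R]_(n, p)) : psdmx (N *m N^T).
Proof.
rewrite -[N in N *m _]mulmx1; apply: psdmx_congr; split.
  by apply/symmetricmxP; rewrite trmx1.
by move=> x; rewrite mulmx1 sqnorm_ge0.
Qed.

Lemma psdmx_scalar (n : nat) (a : R) : 0 <= a -> psdmx (a%:M : 'M_n).
Proof.
move=> a0; rewrite -scalemx1; apply: psdmxZ => //.
by have := psdmx_gram (1%:M : 'M_n); rewrite trmx1 mulmx1.
Qed.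

Lemma pdmx_psd (n : nat) (A : 'M[R]_n) : pdmx A -> psdmx A.
Proof.
move=> [sA pA]; split=> // x; have [->|/pA/ltW //] := eqVneq x 0.
by rewrite mulmx0 mxE.
Qed.

Lemma psdmx_ulsub (p n : nat) (A : 'M[R]_p) B C (D : 'M[R]_n) :
  psdmx (block_mx A B C D) -> psdmx A.
Proof.
move=> /(psdmx_congr (row_mx 1%:M 0)); rewrite tr_row_mx trmx1 trmx0.
by rewrite mul_row_block mul_row_col !mul1mx !mul0mx !mulmx0 mulmx1 !addr0.
Qed.

(** Congruence by the block row [[1, - B C^-1]], which cancels the off-diagonal block. *)
Lemma schur_psdmx (p n : nat) (A : 'M[R]_p) (B : 'M[R]_(p, n)) (C : 'M[R]_n) :
  C \in unitmx -> psdmx (block_mx A B B^T C) ->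
  psdmx (A - B *m invmx C *m B^T).
Proof.
move=> uC /(psdmx_congr (row_mx 1%:M (- (B *m invmx C)))).
rewrite mul_row_block tr_row_mx trmx1 mul_row_col !mul1mx mulmx1 !mulNmx.
by rewrite mulmxKV // subrr mul0mx addr0.
Qed.

(** The block matrix is the congruence of [C] by the column of [N] over [1]. *)
Lemma psdmx_block_gram (p n : nat) (N : 'M[R]_(p, n)) (C : 'M[R]_n) :
  psdmx C ->
  psdmx (block_mx (N *m C *m N^T) (N *m C) (C *m N^T) C).
Proof.
move=> /(psdmx_congr (col_mx N 1%:M)).
by rewrite tr_col_mx trmx1 mul_col_mx mul_col_row !mulmx1 !mul1mx.
Qed.

Lemma psdmx_zero_pivot (n : nat) (b : 'rV[R]_n) (D : 'M[R]_n) :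
  psdmx (block_mx (0 : 'M_1) b b^T D) -> b = 0.
Proof.
move=> [_ p]; apply/rowP => j; rewrite mxE; apply/eqP/negPn/negP => bj0.
(* At the vector [(s, e_j)] the form equals [2 s b_j + D_jj]; this [s] makes it [-1]. *)
pose s : R := - (D j j + 1) / (2 * b 0 j).
have := p (col_mx s%:M (delta_mx j 0)).
rewrite tr_col_mx mul_row_block mul_row_col tr_scalar_mx trmx_delta.
rewrite mulmx0 add0r !mulmxDl.
rewrite mul_mx_scalar !mul_scalar_mx -!rowE -scalemxAl -!colE !mxE.
suff -> : s * b 0 j + (s * b 0 j + D j j) = -1 by rewrite oppr_ge0 ler10.
by rewrite /s; field.
Qed.

(** Induction on the size, splitting off the first row and column. Writing [b = a c] expresses the
    Schur complement of the pivot as [D - c^T b], which also makes sense for [a = 0]. *)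
Lemma psdmx_cholesky (n : nat) (A : 'M[R]_n) :
  psdmx A -> exists W : 'M[R]_n, A = W *m W^T.
Proof.
elim: n A => [|n IH] A pA.
  by exists 0; rewrite [A]flatmx0 [RHS]flatmx0.
rewrite -[n.+1]/(1 + n)%N in A pA *.
have := psdmx_tr pA; move: pA; rewrite -[A]submxK tr_block_mx.
set b := ursubmx A; set D := drsubmx A => /[swap] /eq_block_mx[_ _ <- _].
rewrite [ulsubmx A]mx11_scalar; set a : R := ulsubmx A 0 0 => pA.
have a0 : 0 <= a.
  have [_ /(_ 1%:M)] := psdmx_ulsub pA.
  by rewrite trmx1 mul1mx mulmx1 mxE eqxx mulr1n.
(* A zero pivot forces [b = 0], and then [c = 0] works. *)
have [c defb] : exists c : 'rV_n, b = a *: c.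
  have [a_eq0|a_neq0] := eqVneq a 0; last first.
    by exists (a^-1 *: b); rewrite scalerKV.
  exists 0; rewrite scaler0.
  by move: pA; rewrite a_eq0 raddf0 => /psdmx_zero_pivot.
have [|W' defW] := IH (D - c^T *m b).
  have := psdmx_congr (row_mx (- c^T) 1%:M) pA.
  rewrite mul_row_block tr_row_mx trmx1 mul_row_col !mul1mx mulmx1.
  have -> : - c^T *m a%:M = - b^T by rewrite defb linearZ mulNmx mul_mx_scalar.
  by rewrite addNr mul0mx add0r mulNmx addrC.
pose r := Num.sqrt a.
have rr : r * r = a by rewrite -expr2 sqr_sqrtr.
(* The first column is [sqrt a] times [(1, c^T)]; [W'] factors the Schur complement. *)
exists (block_mx r%:M 0 (r *: c^T) W' : 'M_(1 + n)).
rewrite tr_block_mx mulmx_block tr_scalar_mx !trmx0 !mulmx0 !mul0mx !addr0.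
rewrite linearZ /= trmxK -scalar_mxM rr -defW mul_scalar_mx mul_mx_scalar.
rewrite -scalemxAl -scalemxAr !scalerA rr defb linearZ /=.
by rewrite -scalemxAr addrC subrK.
Qed.

Lemma psdmx_trace_ge0 (n : nat) (A : 'M[R]_n) : psdmx A -> 0 <= \tr A.
Proof.
move=> [_ pA]; apply: sumr_ge0 => i _.
by have := pA (delta_mx i 0); rewrite trmx_delta -rowE -colE !mxE.
Qed.

(** With [A = W W^T], cyclicity turns the trace into that of the congruence [W^T B W]. *)
Lemma psdmx_trace_mul_ge0 (n : nat) (A B : 'M[R]_n) :
  psdmx A -> psdmx B -> 0 <= \tr (A *m B).
Proof.
move=> /psdmx_cholesky[W ->] pB; rewrite -mulmxA mxtrace_mulC.
by have := psdmx_trace_ge0 (psdmx_congr W^T pB); rewrite trmxK.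
Qed.

Lemma psdmx_trace_mul_le (n : nat) (A B C : 'M[R]_n) :
  psdmx A -> psdmx (C - B) -> \tr (A *m B) <= \tr (A *m C).
Proof.
move=> pA /(psdmx_trace_mul_ge0 pA).
by rewrite mulmxBr linearB /= subr_ge0.
Qed.

(** If [v A = 0], the form of [A - a I] at [v^T] is [- a |v|^2], hence [v = 0]. *)
Lemma unitmx_psd_sub_scalar (n : nat) (a : R) (A : 'M[R]_n) :
  0 < a -> psdmx (A - a%:M) -> A \in unitmx.
Proof.
move=> a0 [_ pA]; rewrite -row_free_unit; apply: inj_row_free => v vA.
have := pA v^T; rewrite trmxK mulmxBr vA sub0r mulNmx mul_mx_scalar.
rewrite -scalemxAl mxE [X in - X]mxE oppr_ge0 pmulr_rle0 // => v0.
by rewrite -[v]trmxK (@sqnorm_le0 _ _ v^T) ?trmx0 ?trmxK.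
Qed.

End PositiveSemidefinite.

(** * The discrete Lyapunov equation under a strict certificate [P] *)

Section Lyapunov.

Variable R : realType.

(* Telescoping along the orbit of u: n f(u) + t p(u) >= 0 for every n. *)
Lemma descent_ge0 (U : Type) (g : U -> U) (f p : U -> R) (t : R) :
  0 <= t -> (forall u, 0 <= p u) -> (forall u, f (g u) <= f u) ->
  (forall u, - (t * (p u - p (g u))) <= f u) ->
  forall u, 0 <= f u.
Proof.
move=> t0 p0 fg fp u; rewrite leNgt; apply/negP => fu.
have tel k w : 0 <= k%:R * f w + t * p w.
  elim: k w => [|k IH] w; first by rewrite mul0r add0r mulr_ge0.
  have := ler_wpM2l (ler0n R k) (fg w); have := IH (g w); have := fp w.
  rewrite -[k.+1%:R]natr1; lra.
(* By the Archimedean property some [k] exceeds [t p(u) / - f(u)], which contradicts [tel]. *)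
have tp : 0 <= t * p u / - f u by rewrite divr_ge0 ?mulr_ge0 // oppr_ge0 ltW.
have := archi_boundP tp; rewrite ltr_pdivrMr ?oppr_gt0 //.
have := tel (Num.bound (t * p u / - f u)) u; lra.
Qed.

Variables (n : nat) (A P : 'M[R]_n) (a : R).
Hypotheses (a_gt0 : 0 < a) (psd_P : psdmx P).
Hypothesis strict_P : psdmx (P - a%:M - A *m P *m A^T).

(** Along [y -> A^T y] the form of [Y] does not increase, while [a |y|^2] is at most the drop of the
    form of [P]; descent then applies with constant [t / a]. The abstract state [U] covers both a
    single vector and a pair of independent vectors. *)
Lemma lyapunov_bilinear_ge0 (Y : 'M[R]_n) (U : Type) (g : U -> U)
    (x z : U -> 'cV[R]_n) :
  (forall u, x (g u) = A^T *m x u) -> (forall u, z (g u) = A^T *m z u) ->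
  (forall u, 0 <= ((x u)^T *m (Y - A *m Y *m A^T) *m z u) 0 0) ->
  forall u, 0 <= ((x u)^T *m Y *m z u) 0 0.
Proof.
move=> xg zg YA; have [t t0 tY] := bilinear_bound Y.
pose q (y : 'cV_n) := (y^T *m P *m y) 0 0.
have qA y : a * (y^T *m y) 0 0 <= q y - q (A^T *m y).
  have [_ /(_ y)] := strict_P.
  rewrite !mulmxBr !mulmxBl mul_mx_scalar -scalemxAl /q trmx_mul trmxK !mulmxA.
  rewrite !mxE; lra.
apply: (@descent_ge0 _ g _ (fun u => q (x u) + q (z u)) (t / a)) => [|u|u|u].
- by rewrite divr_ge0 // ltW.
- by rewrite addr_ge0 //; apply: psd_P.2.
- have := YA u; rewrite xg zg mulmxBr mulmxBl trmx_mul trmxK !mulmxA.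
  by rewrite !mxE subr_ge0.
apply: le_trans (tY _ _); rewrite lerN2 -mulrA; apply: ler_wpM2l => //.
rewrite ler_pdivlMl // mulrDr xg zg.
have := qA (x u); have := qA (z u); lra.
Qed.

Lemma lyapunov_psd (Y : 'M[R]_n) :
  Y^T = Y -> psdmx (Y - A *m Y *m A^T) -> psdmx Y.
Proof.
move=> sY [_ pY]; split; first exact/symmetricmxP.
by apply: (@lyapunov_bilinear_ge0 Y _ (mulmx A^T) id id) => // x; apply: pY.
Qed.

(** [Y] may be non-symmetric, so orbits of pairs of vectors are used: the bilinear forms of [Y] and
    of [- Y] are both nonnegative, and basis vectors read off the entries. *)
Lemma lyapunov_inj (Y : 'M[R]_n) : Y = A *m Y *m A^T -> Y = 0.
Proof.
move=> YA; pose g (u : 'cV[R]_n * 'cV[R]_n) := (A^T *m u.1, A^T *m u.2).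
have ge0 (Z : 'M_n) (u : 'cV_n * 'cV_n) :
    Z - A *m Z *m A^T = 0 -> 0 <= (u.1^T *m Z *m u.2) 0 0.
  move=> Z0; apply: (@lyapunov_bilinear_ge0 Z _ g fst snd) => // w.
  by rewrite Z0 mulmx0 mul0mx mxE.
have Y0 : Y - A *m Y *m A^T = 0 by rewrite -YA subrr.
apply/matrixP => i j.
pose u : 'cV[R]_n * 'cV[R]_n := (delta_mx i 0, delta_mx j 0).
have := ge0 Y u Y0; have := ge0 (- Y) u.
rewrite mulmxN mulNmx -opprD Y0 oppr0 => /(_ erefl).
rewrite /= trmx_delta mulmxN mulNmx -rowE -colE !mxE oppr_ge0 => le0 ge0Y.
by apply/eqP; rewrite eq_le le0 ge0Y.
Qed.

(** The linear map [Y -> Y - A Y A^T] is injective on a finite-dimensional space, hence bijective;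
    its matrix is inverted after vectorization. *)
Lemma lyapunov_solution (C : 'M[R]_n) : exists Y, Y = C + A *m Y *m A^T.
Proof.
pose f := idfun \- (mulmxr A^T \o mulmx A).
have uf : lin_mx f \in unitmx.
  rewrite -row_free_unit; apply: inj_row_free => v.
  rewrite -[v]vec_mxK mul_vec_lin => /(congr1 vec_mx).
  rewrite mxvecK linear0 /= => /subr0_eq/lyapunov_inj ->.
  by rewrite linear0.
exists (vec_mx (mxvec C *m invmx (lin_mx f))); set Y := vec_mx _.
suff : f Y = C by move=> <-; rewrite /= subrK.
apply: (can_inj mxvecK); rewrite -mul_vec_lin /Y vec_mxK.
by rewrite mulmxKV.
Qed.

Lemma lyapunov_psd_solution : exists2 Y : 'M[R]_n,
  Y = a%:M + A *m Y *m A^T & psdmx Y /\ psdmx (P - Y).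
Proof.
have [Y defY] := lyapunov_solution a%:M; exists Y => //.
have sY : Y^T = Y.
  (* [Y^T - Y] solves the homogeneous equation. *)
  apply/subr0_eq/lyapunov_inj; rewrite {1 2}defY linearD /= tr_scalar_mx.
  by rewrite !trmx_mul trmxK mulmxBr mulmxBl mulmxA opprD addrACA subrr add0r.
split; apply: lyapunov_psd => //.
- by rewrite {1}defY addrK; apply/psdmx_scalar/ltW.
- by rewrite linearB /= sY (psdmx_tr psd_P).
(* The two constant terms cancel, so the residual of [P - Y] is the matrix of [strict_P]. *)
have -> : P - Y - A *m (P - Y) *m A^T = P - a%:M - A *m P *m A^T.
  rewrite {1}defY mulmxBr mulmxBl; move: (A *m P *m A^T) (A *m Y *m A^T) => c d.
  by rewrite !opprD opprK -!addrA; congr (_ + (_ + _)); rewrite addrC addrK.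
exact: strict_P.
Qed.

End Lyapunov.


(** * Exactness of the semidefinite relaxation *)

Section Relaxation.

Context {R : realType} {n m : nat}.

Variables (Q : 'M[R]_n) (Rc : 'M[R]_m) (sigma_w lambda : R).
Variables (Psi : 'M[R]_(m + n)) (X1bar : 'M[R]_(n, m + n)).

Let Psi1 : 'M[R]_(m, m + n) := usubmx Psi.

(** All three block matrices are congruences of [Sigma], with [N] equal to [X1bar V], [Psi1 V] and
    [V]; the Lyapunov equation supplies the upper left block of the first. *)
Lemma direct_feasible_sdp (V : 'M[R]_(m + n, n)) (Sigma : 'M[R]_n) :
  direct_feasible sigma_w Psi X1bar V Sigma ->
  sdp_feasible sigma_w Psi X1bar Sigma (V *m Sigma)
    (Psi1 *m V *m Sigma *m (Psi1 *m V)^T) (V *m Sigma *m V^T).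
Proof.
move=> [pS defS V1]; have sS := psdmx_tr pS; split; first split.
- exact: pS.1.
- exact: (psdmx_congr _ pS).1.
- exact: (psdmx_congr _ pS).1.
rewrite !trmx_mul sS; split; first by rewrite mulmxA -V1 mul1mx.
- rewrite {1}defS addrAC subrr add0r.
  by have := psdmx_block_gram (X1bar *m V) pS; rewrite trmx_mul !mulmxA.
- by have := psdmx_block_gram (Psi1 *m V) pS; rewrite trmx_mul !mulmxA.
exact: psdmx_block_gram.
Qed.

Lemma direct_cost_sdp (V : 'M[R]_(m + n, n)) (Sigma : 'M[R]_n) :
  sdp_cost Q Rc lambda Psi Sigma (V *m Sigma)
    (Psi1 *m V *m Sigma *m (Psi1 *m V)^T) (V *m Sigma *m V^T) =
  direct_cost Q Rc lambda Psi V Sigma.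
Proof.
rewrite /sdp_cost /direct_cost mulmxDl [in RHS]linearD /= -/Psi1.
congr (_ + _ + _ * _).
  by rewrite mulmxA mxtrace_mulC trmx_mul !mulmxA.
by rewrite mxtrace_mulC !mulmxA.
Qed.

Hypotheses (psd_Q : psdmx Q) (psd_Rc : psdmx Rc) (psd_Psi : psdmx Psi).
Hypotheses (sigma_w_gt0 : 0 < sigma_w) (lambda_ge0 : 0 <= lambda).

Lemma sdp_feasible_unit Sigma S L M :
  sdp_feasible sigma_w Psi X1bar Sigma S L M -> Sigma \in unitmx.
Proof.
by move=> [_ [_ /psdmx_ulsub/unitmx_psd_sub_scalar-> //]]; rewrite exprn_gt0.
Qed.

Lemma sdp_feasible_direct Sigma S L M :
  sdp_feasible sigma_w Psi X1bar Sigma S L M ->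
  exists2 Sigma',
    direct_feasible sigma_w Psi X1bar (S *m invmx Sigma) Sigma' &
    direct_cost Q Rc lambda Psi (S *m invmx Sigma) Sigma'
      <= sdp_cost Q Rc lambda Psi Sigma S L M.
Proof.
move=> feas; have uS := sdp_feasible_unit feas.
have [_ [Psi2S pX pL pM]] := feas; set V := S *m invmx Sigma.
have defS : S = V *m Sigma by rewrite mulmxKV.
(* The lower left blocks become transposes of the upper right ones, ready for Schur complements; the
   first block matrix is also kept, to show [Sigma] positive semidefinite. *)
move: pX pL pM; rewrite -!trmx_mul => /[dup] /(schur_psdmx uS) pX pblock.
move=> /(schur_psdmx uS) pL /(schur_psdmx uS) pM.
have pS : psdmx Sigma.
  rewrite -[Sigma](subrK (sigma_w ^+ 2)%:M); apply: psdmxD.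
    exact: psdmx_ulsub pblock.
  exact/psdmx_scalar/sqr_ge0.
(* Rewrites all three Schur complement terms in terms of [V], taking [N] to be [X1bar], [Psi1] and
   the identity. *)
have VV p (N : 'M_(p, _)) :
    N *m S *m invmx Sigma *m (N *m S)^T = N *m V *m Sigma *m (N *m V)^T.
  rewrite {1 2}defS !trmx_mul (psdmx_tr pS) !mulmxA.
  by rewrite mulmxK.
have := VV _ 1%:M; rewrite !mul1mx => VV1.
move: pX pL pM; rewrite !VV VV1 => pX pL pM.
(* [pX] is the strict Lyapunov inequality for [A = X1bar V], [P = Sigma], [a = sigma_w^2]. *)
have [Sigma' defS' [pS' leS']] :=
  lyapunov_psd_solution (exprn_gt0 2 sigma_w_gt0) pS pX.
exists Sigma'.
  split=> //; first by rewrite {1}defS' trmx_mul !mulmxA.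
  by rewrite mulmxA Psi2S mulmxV.
(* The intermediate value is the direct cost at [(V, Sigma)], a pair satisfying the covariance
   equation only as an inequality. First [Sigma'] is compared with [Sigma], then [L] and [M] with
   their lower bounds. *)
apply: (@le_trans _ _ (direct_cost Q Rc lambda Psi V Sigma)).
  rewrite /direct_cost; apply: lerD.
    apply: psdmx_trace_mul_le => //; apply: psdmxD => //.
    have := psdmx_congr (Psi1 *m V)^T psd_Rc.
    by rewrite trmxK trmx_mul !mulmxA.
  apply: ler_wpM2l => //; rewrite -!mulmxA; apply: psdmx_trace_mul_le => //.
  rewrite !mulmxA -mulmxBl -mulmxBr; exact: psdmx_congr.
rewrite -direct_cost_sdp /sdp_cost; apply: lerD; first apply: lerD => //.
  exact: psdmx_trace_mul_le.
apply: ler_wpM2l => //; rewrite ![\tr (_ *m Psi)]mxtrace_mulC.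
exact: psdmx_trace_mul_le.
Qed.

(** Every direct competitor embeds in the semidefinite program at equal cost, so the optimal value
    there bounds it from below, and the recovered pair costs no more than that value. *)
Lemma sdp_optimal_direct Sigma S L M :
  sdp_optimal Q Rc sigma_w lambda Psi X1bar Sigma S L M ->
  exists Sigma',
    direct_optimal Q Rc sigma_w lambda Psi X1bar (S *m invmx Sigma) Sigma'.
Proof.
move=> [feas opt]; have [Sigma' feas' le'] := sdp_feasible_direct feas.
exists Sigma'; split=> // V0 Sigma0 /direct_feasible_sdp /opt.
by rewrite direct_cost_sdp; apply: le_trans.
Qed.

End Relaxation.

(** * Application to the data matrices *)

Lemma psdmx_Psi (R : realType) (n m T : nat) (sigma_w : R)
    (D0 : 'M[R]_(m + n, T)) (Omega : 'M[R]_(m + n)) :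
  psdmx Omega -> psdmx (Psi_mx sigma_w D0 Omega).
Proof.
move=> pO; apply: psdmxZ; first by rewrite invr_ge0 ler0n.
by apply: psdmxD; [apply: psdmx_gram | apply: psdmxZ; rewrite ?sqr_ge0].
Qed.

Theorem proposition1 (R : realType) (n m T : nat)
  (X0 : 'M[R]_(n, T)) (U0 : 'M[R]_(m, T)) (X1 : 'M[R]_(n, T))
  (Bbar : 'M[R]_(n, m)) (Abar : 'M[R]_n)
  (OmegaB : 'M[R]_m) (OmegaA : 'M[R]_n)
  (Q : 'M[R]_n) (Rc : 'M[R]_m) (sigma_w lambda : R)
  (rank_D0 : \rank (data_mx U0 X0) = (n + m)%N)
  (psd_Omega : psdmx (prior_weight OmegaB OmegaA))
  (psd_Q : psdmx Q) (pd_Rc : pdmx Rc)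
  (sigma_w_gt0 : 0 < sigma_w) (lambda_ge0 : 0 <= lambda) :
  let D0 := data_mx U0 X0 in
  let Omega := prior_weight OmegaB OmegaA in
  let Psi := Psi_mx sigma_w D0 Omega in
  let Psi1 := usubmx Psi in
  let X1bar := X1bar_mx sigma_w X1 D0 (prior_mean Bbar Abar) Omega in
  (exists (V : 'M[R]_(m + n, n)) (Sigma : 'M[R]_n),
     direct_feasible sigma_w Psi X1bar V Sigma) ->
  forall (Sigma : 'M[R]_n) (S : 'M[R]_(m + n, n)) (L : 'M[R]_m)
         (M : 'M[R]_(m + n)),
    sdp_optimal Q Rc sigma_w lambda Psi X1bar Sigma S L M ->
    Sigma \in unitmx /\
    direct_optimal_gain Q Rc sigma_w lambda Psi X1bar
      (Psi1 *m S *m invmx Sigma).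
Proof.
move=> D0 Omega Psi Psi1 X1bar _ Sigma S L M opt.
split; first exact: sdp_feasible_unit opt.1.
have pPsi : psdmx Psi by apply: psdmx_Psi.
have [Sigma' opt'] :=
  sdp_optimal_direct psd_Q (pdmx_psd pd_Rc) pPsi sigma_w_gt0 lambda_ge0 opt.
by exists (S *m invmx Sigma), Sigma'; rewrite mulmxA.
Qed.
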